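(* Let $\alpha, g$ be positive integers with $g\geq 3\alpha-1$. Then there is a bijection between the set of numerical semigroups with genus $g$ and type $g-\alpha$ and the set of numerical sets $T$ for which $g(A(T))=\alpha$.
   Context: $\mathbb{N}=\{0,1,2,\dots\}$. A numerical set is a subset $T\subseteq\mathbb{N}$ containing $0$ with finite complement in $\mathbb{N}$; a numerical semigroup is a numerical set closed under addition. Elements of $\mathbb{N}\setminus T$ are the gaps of $T$; the genus $g(T)$ is the number of gaps. The numerical semigroup associated to a numerical set $T$ is $A(T)=\{x\in\mathbb{N}\mid x+y\in T\text{ for all }y\in T\}$. For a numerical semigroup $S$, $PF(S)=\{x\in\mathbb{N}\setminus S \mid x+s\in S \text{ for all } s\in S\setminus\{0\}\}$ and the type is $t(S)=|PF(S)|$. *)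

(* Defs.v *)
From mathcomp Require Import all_boot finmap.
From mathcomp Require Import boolp classical_sets functions cardinality.

Set Implicit Arguments.
Unset Strict Implicit.
Unset Printing Implicit Defensive.

Local Open Scope classical_set_scope.

Definition gaps (T : set nat) : set nat := ~` T.

Definition numerical_set (T : set nat) : Prop := T 0 /\ finite_set (gaps T).

Definition numerical_semigroup (S : set nat) : Prop :=
  numerical_set S /\ forall x y, S x -> S y -> S (x + y).

(* [fset_set] sends infinite sets to the empty set, so [genus T] is meaningful
   only when T has finitely many gaps. *)
Definition genus (T : set nat) : nat := #|` fset_set (gaps T)|.

Definition assoc_semigroup (T : set nat) : set nat :=
  [set x | forall y, T y -> T (x + y)].

Definition pseudo_frobenius (S : set nat) : set nat :=
  [set x | ~ S x /\ forall s, S s -> s != 0 -> S (x + s)].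

(* Pseudo-Frobenius numbers are gaps, so this is a genuine cardinality whenever
   S has finitely many gaps. *)
Definition semigroup_type (S : set nat) : nat :=
  #|` fset_set (pseudo_frobenius S)|.

(* Main.v *)
(* A numerical semigroup S of multiplicity m is {0} with m + T, where T = S - m
   is a numerical set.  A gap x of S is pseudo-Frobenius iff x + m + T lies in
   m + T, i.e. iff x is in A(T); since S is contained in A(T), it follows that
   t(S) = g(S) - g(A(T)).  So S |-> S - m maps into the right set, and it is
   injective because g(S) = m - 1 + g(T) recovers m from T.  Conversely,
   {0} with m + T is closed under addition as soon as every gap of T is less
   than m.  For m = g + 1 - g(T) this holds: a gap x of T is a gap of A(T), so
   x + 1 <= 2 g(A(T)) = 2 alpha, and g(T) <= g(A(T)) = alpha. *)
Require Import Defs.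
From mathcomp Require Import all_boot finmap zify.
From mathcomp Require Import boolp classical_sets functions cardinality.

Local Open Scope classical_set_scope.

(** * Cardinalities of finite sets *)

Lemma card_fset_setU (T : choiceType) (A B : set T) :
  finite_set A -> finite_set B -> A `&` B = set0 ->
  #|` fset_set (A `|` B)| = #|` fset_set A| + #|` fset_set B|.
Proof.
move=> fA fB AB0; rewrite fset_setU // -cardfsUI -fset_setI // AB0.
by rewrite fset_set0 cardfs0 addn0.
Qed.

Lemma card_fset_set_image (T U : choiceType) (f : T -> U) (A : set T) :
  injective f -> finite_set A -> #|` fset_set (f @` A)| = #|` fset_set A|.
Proof. by move=> f_inj fA; rewrite fset_set_image // card_imfset. Qed.

Lemma subset_card_fset_set (T : choiceType) (A B : set T) :
  finite_set B -> A `<=` B -> #|` fset_set A| <= #|` fset_set B|.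
Proof.
move=> fB AB; have fA := sub_finite_set AB fB.
by apply: fsubset_leq_card; rewrite -fset_set_sub.
Qed.

Lemma finite_set_nat_bounded (A : set nat) :
  finite_set A -> exists n, A `<=` `I_n.
Proof.
move=> fA; exists (\max_(x <- fset_set A) x).+1 => x Ax /=.
by rewrite ltnS leq_bigmax_seq // in_fset_set // inE.
Qed.

(** * Gaps of the associated semigroup *)

Lemma gaps_assoc_sub (T : set nat) : T 0 -> gaps T `<=` gaps (assoc_semigroup T).
Proof. by move=> T0 x xNT /(_ 0 T0); rewrite addn0. Qed.

Lemma numerical_semigroup_assoc (T : set nat) :
  numerical_set T -> numerical_semigroup (assoc_semigroup T).
Proof.
case=> T0 fT; split; last first.
  by move=> x y Ax Ay z Tz; rewrite -addnA; apply/Ax/Ay.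
split=> //; have [n Tn] := finite_set_nat_bounded _ fT.
apply: sub_finite_set (finite_II n) => x xNA /=.
(* If [n <= x], every [x + y] lies beyond all gaps of T, which puts x in A(T). *)
have [//|nx] := ltnP x n; case: xNA => y Ty.
by apply: contrapT => /Tn /=; rewrite ltnNge (leq_trans nx) ?leq_addr.
Qed.

(* For each i <= x, one of i and x - i is a gap. *)
Lemma gap_lt_double_genus (S : set nat) (x : nat) :
  numerical_semigroup S -> gaps S x -> x < (genus S).*2.
Proof.
move=> [[S0 fS] SD] xNS.
have cover : `I_x.+1 `<=` gaps S `|` subn x @` gaps S.
  move=> i /= ix; case: (pselect (S i)) => Si; last by left.
  right; exists (x - i); last by rewrite subKn.
  by move=> /(SD _ _ Si); rewrite subnKC.
have fim : finite_set (subn x @` gaps S) by exact: finite_image.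
have := subset_card_fset_set _ _ _ _ cover.
rewrite finite_setU => /(_ (conj fS fim)).
rewrite (card_fset_set (card_eqxx _)) => /leq_trans; apply.
rewrite fset_setU // cardfsU (leq_trans (leq_subr _ _)) // -addnn leq_add2l.
by rewrite fset_set_image // leq_imfset_card.
Qed.

(** * The set {0} with m + T: gaps, type and closure *)

Definition shift0 (m : nat) (T : set nat) : set nat :=
  0 |` (addn m @` T).

Lemma shift0_add (m : nat) (T : set nat) (x : nat) :
  0 < m -> shift0 m T (m + x) = T x.
Proof.
move=> m_gt0; apply/propext; split=> [[/= | [y Ty /addnI <-] //] | Tx]; first by lia.
by right; exists x.
Qed.

(** Adjoining 0 completes the gaps 1, ..., m - 1 to [I_m], so both sides are disjoint unions and no
    truncated m - 1 appears. *)
Lemma gaps_shift0 (m : nat) (T : set nat) :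
  0 < m -> 0 |` gaps (shift0 m T) = `I_m `|` addn m @` gaps T.
Proof.
move=> m_gt0; apply/seteqP; split=> x.
  case=> [-> | xNS]; first by left.
  have [xm | mx] := ltnP x m; [by left | right].
  exists (x - m); last exact: subnKC.
  by rewrite /gaps /= -(shift0_add m) // subnKC.
case=> [/= xm | [y yNT <-]]; last by right; rewrite /gaps/= shift0_add.
case: x xm => [|x] xm; [by left | right].
by case=> [|[y _ e]]; [discriminate | move: xm; rewrite -e ltnNge leq_addr].
Qed.

Lemma finite_gaps_shift0 (m : nat) (T : set nat) :
  0 < m -> finite_set (gaps T) -> finite_set (gaps (shift0 m T)).
Proof.
move=> m_gt0 fT.
apply: (@sub_finite_set _ _ (0 |` gaps (shift0 m T))); first by move=> x; right.
by rewrite gaps_shift0 // finite_setU; split=> //; apply: finite_image.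
Qed.

Lemma genus_shift0 (m : nat) (T : set nat) :
  0 < m -> finite_set (gaps T) -> (genus (shift0 m T)).+1 = m + genus T.
Proof.
move=> m_gt0 fT; have fS := finite_gaps_shift0 _ _ m_gt0 fT.
have := congr1 (fun A => #|` fset_set A|) (gaps_shift0 m T m_gt0).
rewrite !card_fset_setU //; last 3 first.
- exact: finite_image.
- apply/seteqP; split=> x // [/= xm [y _ e]].
  by move: xm; rewrite -e ltnNge leq_addr.
- by apply/seteqP; split=> x // [/= ->]; apply; left.
rewrite fset_set1 cardfs1 (card_fset_set (card_eqxx _)).
by rewrite card_fset_set_image // => x y /addnI.
Qed.

(** By closure x + (m + y) = m + (x + y) is an element of [shift0 m T], which forces x + y into
    T. *)
Lemma shift0_sub_assoc (m : nat) (T : set nat) :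
  0 < m ->
  (forall x y, shift0 m T x -> shift0 m T y -> shift0 m T (x + y)) ->
  shift0 m T `<=` assoc_semigroup T.
Proof.
move=> m_gt0 closed x Sx y Ty; rewrite -(shift0_add m) // addnCA.
by apply: closed => //; rewrite shift0_add.
Qed.

Lemma pseudo_frobenius_shift0 (m : nat) (T : set nat) :
  0 < m ->
  (forall x y, shift0 m T x -> shift0 m T y -> shift0 m T (x + y)) ->
  pseudo_frobenius (shift0 m T) =
  gaps (shift0 m T) `\` gaps (assoc_semigroup T).
Proof.
move=> m_gt0 closed; apply/seteqP; split=> x [xNS xP]; split=> //.
  apply=> y Ty; rewrite -(shift0_add m) // addnCA.
  by apply: xP; rewrite ?shift0_add //; lia.
move=> s [-> // | [y Ty <-] _]; rewrite addnCA shift0_add //.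
by move/contrapT: xP; apply.
Qed.

(** The inequality makes the truncated subtraction a true difference. *)
Lemma genus_assoc_shift0 (m : nat) (T : set nat) :
  0 < m ->
  (forall x y, shift0 m T x -> shift0 m T y -> shift0 m T (x + y)) ->
  finite_set (gaps T) ->
  genus (assoc_semigroup T) <= genus (shift0 m T) /\
  semigroup_type (shift0 m T) =
    genus (shift0 m T) - genus (assoc_semigroup T).
Proof.
move=> m_gt0 closed fT; have fS := finite_gaps_shift0 _ _ m_gt0 fT.
have AS : gaps (assoc_semigroup T) `<=` gaps (shift0 m T).
  by apply: subsetC; apply: shift0_sub_assoc.
have fA := sub_finite_set AS fS.
split; first exact: subset_card_fset_set.
rewrite /semigroup_type pseudo_frobenius_shift0 // fset_setD // cardfsDS //.
by rewrite -fset_set_sub.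
Qed.

Lemma shift0_closed (m : nat) (T : set nat) :
  gaps T `<=` `I_m ->
  forall x y, shift0 m T x -> shift0 m T y -> shift0 m T (x + y).
Proof.
move=> Tm x y [-> // | [a Ta <-]] [-> | [b Tb <-]].
  by rewrite addn0; right; exists a.
(* The witness is at least m, hence larger than every gap of T. *)
right; exists (a + (m + b)); last by rewrite addnA.
by apply: contrapT => /Tm /=; lia.
Qed.

(** * Multiplicity and the inverse shift *)

Definition is_multiplicity (S : set nat) (m : nat) : Prop :=
  [/\ S m, 0 < m & forall x, S x -> 0 < x -> m <= x].

Lemma multiplicity_exists (S : set nat) :
  numerical_set S -> exists m, is_multiplicity S m.
Proof.
case=> _ /finite_set_nat_bounded [n Sn].
have : exists x, `[< S x >] && (0 < x).
  (* The successor guarantees positivity, since n may be 0. *)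
  exists n.+1; rewrite andbT; apply/asboolP; apply: contrapT => /Sn /=; lia.
move=> ex; case: (ex_minnP ex) => m /andP[/asboolP Sm m_gt0] m_min.
by exists m; split=> // x Sx x_gt0; apply: m_min; rewrite x_gt0 andbT asboolT.
Qed.

Lemma multiplicity_uniq (S : set nat) (m n : nat) :
  is_multiplicity S m -> is_multiplicity S n -> m = n.
Proof.
move=> [Sm m0 mP] [Sn n0 nP]; apply/eqP.
by rewrite eqn_leq mP // nP.
Qed.

Lemma multiplicity_shift0 (m : nat) (T : set nat) :
  0 < m -> T 0 -> is_multiplicity (shift0 m T) m.
Proof.
move=> m_gt0 T0; split=> //; first by right; exists 0; rewrite ?addn0.
by move=> x [-> // | [y _ <-] _]; rewrite leq_addr.
Qed.

(* S - m with m the multiplicity of S, written as a relation on m since the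
   multiplicity is only defined when S has a positive element. *)
Definition unshift (S : set nat) : set nat :=
  [set x | exists2 m, is_multiplicity S m & S (m + x)].

Lemma unshiftE (S : set nat) (m x : nat) :
  is_multiplicity S m -> unshift S x = S (m + x).
Proof.
move=> mS; apply/propext; split; last by exists m.
by case=> n nS; rewrite (multiplicity_uniq _ _ _ mS nS).
Qed.

Lemma shift0_unshift (S : set nat) (m : nat) :
  S 0 -> is_multiplicity S m -> shift0 m (unshift S) = S.
Proof.
move=> S0 mS; have [Sm m_gt0 mP] := mS; apply/seteqP; split=> x.
  by case=> [-> // | [y Ty <-]]; rewrite -(unshiftE _ _ _ mS).
move=> Sx; case: (posnP x) => [-> | x_gt0]; first by left.
by right; exists (x - m); rewrite ?(unshiftE _ _ _ mS) subnKC ?mP.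
Qed.

Lemma unshift_shift0 (m : nat) (T : set nat) :
  0 < m -> T 0 -> unshift (shift0 m T) = T.
Proof.
move=> m_gt0 T0; have mS := multiplicity_shift0 _ _ m_gt0 T0.
by apply/seteqP; split=> x; rewrite (unshiftE _ _ _ mS) shift0_add.
Qed.

Lemma numerical_set_unshift (S : set nat) (m : nat) :
  numerical_set S -> is_multiplicity S m -> numerical_set (unshift S).
Proof.
move=> [S0 fS] mS; have [Sm _ _] := mS.
split; first by rewrite (unshiftE _ _ _ mS) addn0.
have := finite_preimage (f := addn m) (B := gaps S).
move=> /(_ (in2W (@addnI m)) fS); apply: sub_finite_set => x.
by rewrite /gaps /= (unshiftE _ _ _ mS).
Qed.

Theorem theorem3p4 (alpha g : nat) (alpha_gt0 : 0 < alpha) (g_gt0 : 0 < g)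
    (hg : 3 * alpha - 1 <= g) :
  exists f : set nat -> set nat,
    set_bij
      [set S | [/\ numerical_semigroup S, genus S = g
                 & semigroup_type S = g - alpha]]
      [set T | numerical_set T /\ genus (assoc_semigroup T) = alpha]
      f.
Proof.
exists unshift; split.
- move=> S [[nS SD] gS tS]; have [S0 _] := nS.
  have [m mS] := multiplicity_exists _ nS; have [_ m_gt0 _] := mS.
  have nT := numerical_set_unshift _ _ nS mS; split=> //.
  (* Closure, genus and type are restated for {0} with m + T, where T = [unshift S]; the goal keeps
     T. *)
  move: SD gS tS; rewrite -{1 2 3 4 5}(shift0_unshift _ _ S0 mS) => SD gS.
  have [] := genus_assoc_shift0 _ _ m_gt0 SD nT.2.
  (* [hg] and [alpha_gt0] give alpha <= g, so g - g(A(T)) = g - alpha cancels. *)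
  by rewrite gS => ? ->; lia.
- move=> S1 S2; rewrite !inE => -[[nS1 _] g1 _] [[nS2 _] g2 _] eqT.
  have [m1 mS1] := multiplicity_exists _ nS1.
  have [m2 mS2] := multiplicity_exists _ nS2.
  have [_ m1_gt0 _] := mS1; have [_ m2_gt0 _] := mS2.
  have E1 := shift0_unshift _ _ nS1.1 mS1.
  have E2 := shift0_unshift _ _ nS2.1 mS2.
  have [_ fT1] := numerical_set_unshift _ _ nS1 mS1.
  have [_ fT2] := numerical_set_unshift _ _ nS2 mS2.
  have := genus_shift0 _ _ m1_gt0 fT1; have := genus_shift0 _ _ m2_gt0 fT2.
  (* With T the common image, m1 + g(T) and m2 + g(T) both equal g + 1. *)
  rewrite E1 E2 g1 g2 eqT => -> /addIn m12.
  by rewrite -E1 -E2 eqT m12.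
- move=> T [nT gA]; have [T0 fT] := nT.
  have nA := numerical_semigroup_assoc _ nT.
  have TA := gaps_assoc_sub _ T0.
  have gT : genus T <= alpha.
    by rewrite -gA; apply: subset_card_fset_set TA; case: nA => -[].
  (* Forced by [genus_shift0]: the genus m + g(T) - 1 must be g. *)
  pose m := g.+1 - genus T.
  have m_gt0 : 0 < m by rewrite /m; lia.
  have Tm : gaps T `<=` `I_m.
    move=> x /TA /(gap_lt_double_genus _ _ nA) /=.
    (* Here x < 2 alpha, while g(T) <= alpha and g >= 3 alpha - 1 give m >= 2 alpha. *)
    by rewrite gA /m; lia.
  have SD := shift0_closed _ _ Tm.
  have gS : genus (shift0 m T) = g.
    by have := genus_shift0 _ _ m_gt0 fT; rewrite /m; lia.
  exists (shift0 m T); last exact: unshift_shift0.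
  split=> //; last first.
    by have [_ ->] := genus_assoc_shift0 _ _ m_gt0 SD fT; rewrite gS gA.
  by split=> //; split; [left | exact: finite_gaps_shift0].
Qed.
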